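(* Let $g\ge 3$ and $2\le k<g$ be integers such that $k+1$ divides $g$, and suppose that the $(g,k)$ Young graph exists and is the 1089 graph. Let $b=g/(k+1)$. Then: (i) The $(g,k)$ Young graph has the starting node $[[0,0]]$ and the four non-starting nodes $[0,0]$, $[0,k-1]$, $[k-1,k-1]$, $[k-1,0]$, and exactly the following labelled edges: $[[0,0]]\xrightarrow{(b,\,kb)}[0,k-1]$, $[0,0]\xrightarrow{(0,\,0)}[0,0]$, $[0,0]\xrightarrow{(b,\,kb)}[0,k-1]$, $[0,k-1]\xrightarrow{(b-1,\,kb-1)}[k-1,k-1]$, $[k-1,k-1]\xrightarrow{(g-1,\,g-1)}[k-1,k-1]$, $[k-1,k-1]\xrightarrow{(kb-1,\,b-1)}[k-1,0]$, $[k-1,0]\xrightarrow{(kb,\,b)}[0,0]$. The two pivot nodes are $[0,0]$ and $[k-1,k-1]$. (ii) The generating function of the $(g,k)$-reverse multiples is $$\mathcal C(x)=\frac{x^4(1+x)}{1-x^2-x^4}.$$ (iii) The $(g,k)$-reverse multiples are exactly the numbers $\gamma\beta$, where $\gamma=b(g^2-1)=(b-1,\,g-1,\,kb)_g$ and $\beta$ ranges over all positive integers whose base-$g$ expansion is palindromic, uses only the digits $0$ and $1$, and contains no single $0$'s or $1$'s (i.e. every maximal run of consecutive equal digits has length at least $2$). (iv) The shortest $(g,k)$-reverse multiple has length $4$, and for every $t\ge 4$ the number of $(g,k)$-reverse multiples of length $t$ is $F_{\lfloor t/2\rfloor-1}$.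
   Context: Notation: $(a_{n-1},\dots,a_1,a_0)_g$ denotes $\sum_{i=0}^{n-1}a_ig^i$ with digits $0\le a_i<g$; if $a_{n-1}\ne0$ the number has length $n$. For integers $g\ge3$, $2\le k<g$, a positive integer $N=(a_{n-1},\dots,a_0)_g$ with $a_{n-1}\neq 0$ is a $(g,k)$-reverse multiple if $kN=(a_0,a_1,\dots,a_{n-1})_g$ (the base-$g$ reversal of $N$, in particular $a_0\ne0$). Let $c_t$ be the number of $(g,k)$-reverse multiples of length $t$ and $\mathcal C(x)=\sum_{t\ge0}c_tx^t$. $F_n$ denotes the Fibonacci numbers with $F_1=F_2=1$, $F_{n}=F_{n-1}+F_{n-2}$. Young graph. The directed edge-labelled graph $H(g,k)$ is defined as follows. Its possible nodes are a distinguished starting node, written $[[0,0]]$, and ordered pairs $[s,r]$ of integers with $0\le s,r\le k-1$ (the pair $[0,0]$ is a node distinct from the starting node). For a node $[s,r]$ (the starting node being treated as $s=r=0$) and each pair of digits $(c,a)$, $0\le a,c\le g-1$, with $ka+r\equiv c \pmod g$ and $0\le a+sg-kc\le k-1$, there is a directed edge labelled $(c,a)$ from $[s,r]$ to the node $[\,a+sg-kc,\ (ka+r-c)/g\,]$; for edges leaving the starting node one additionally requires $a\ne0$ and $c\ne0$. $H(g,k)$ consists of the starting node, the nodes reachable from it by directed paths, and all edges leaving these nodes. A non-starting node of the form $[r,r]$ ($r\ge0$, including $[0,0]$) is an even pivot node; a non-starting node is an odd pivot node if it is of the form $[r,r]$ and carries a loop, or is of the form $[r',r]$ with $r'\ne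 r$ and has an edge to $[r,r']$. The $(g,k)$ Young graph exists if $H(g,k)$ contains a node $[r,r]$ with $r\ne0$ or an edge $[r',r]\to[r,r']$ with $r'\ne r$; it is then obtained from $H(g,k)$ by deleting every node from which no pivot node can be reached by a directed path, together with all edges incident to such nodes. Two Young graphs are isomorphic if there is an isomorphism of the underlying (unlabelled) directed graphs sending starting node to starting node, even pivot nodes onto even pivot nodes and odd pivot nodes onto odd pivot nodes. The 1089 graph: a Young graph is ''the 1089 graph'' if it is isomorphic to the graph with starting node $S$ and non-starting nodes $U,V,W,X$, with edges $S\to V$, $U\to U$, $U\to V$, $V\to W$, $W\to W$, $W\to X$, $X\to U$, in which $U$ and $W$ are both even and odd pivot nodes and $V,X$ are not pivot nodes. *)

(* Defs.v *)
From HB Require Import structures.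
From Stdlib Require Import Relation_Operators.
From mathcomp Require Import all_boot all_order all_algebra.
From mathcomp Require Import zify.

Set Implicit Arguments.
Unset Strict Implicit.
Unset Printing Implicit Defensive.

Import GRing.Theory.

(** * Base-g expansions, least significant digit first *)

(* [(a_{n-1}, ..., a_1, a_0)_g] is [from_digits g [:: a_0; a_1; ...; a_{n-1}]]. *)
Definition from_digits (g : nat) (s : seq nat) : nat :=
  \sum_(i < size s) nth 0 s i * g ^ i.

Definition is_expansion (g N : nat) (s : seq nat) : bool :=
  [&& all (fun d => d < g) s, last 0 s != 0 & from_digits g s == N].

(* For [1 < g] and [0 < N], [trunc_log g N] is the largest [e] with
   [g ^ e <= N]; lemma [digitsP] below shows that [digits g N] is the unique
   base-g expansion of [N]. *)
Definition digits (g N : nat) : seq nat :=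
  if N == 0 then [::]
  else mkseq (fun i => N %/ g ^ i %% g) (trunc_log g N).+1.

Definition base_length (g N : nat) : nat := size (digits g N).

Lemma from_digits_cons g d s : from_digits g (d :: s) = d + g * from_digits g s.
Proof.
rewrite /from_digits big_ord_recl /= expn0 muln1 big_distrr /=; congr (_ + _).
by apply: eq_bigr => i _; rewrite expnS mulnCA.
Qed.

Lemma from_digits_mkseq g N n :
  from_digits g (mkseq (fun i => N %/ g ^ i %% g) n) = N %% g ^ n.
Proof.
elim: n N => [|n IHn] N; first by rewrite /from_digits big_ord0 expn0 modn1.
rewrite /mkseq /= -[1]addn0 iotaDl from_digits_cons expn0 divn1.
have -> : [seq N %/ g ^ i %% g | i <- [seq 1 + i | i <- iota 0 n]] =
          mkseq (fun i => (N %/ g) %/ g ^ i %% g) n.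
  by rewrite -map_comp; apply: eq_map => i /=; rewrite -divnMA -expnS.
rewrite IHn expnS.
case: g {IHn} => [|g]; first by rewrite !mul0n addn0 !modn0.
rewrite [RHS](_ : _ = (N %/ g.+1 * g.+1 + N %% g.+1) %% (g.+1 * g.+1 ^ n)).
  have lt_m : N %/ g.+1 %% g.+1 ^ n < g.+1 ^ n by rewrite ltn_mod expn_gt0.
  have lt_r : N %% g.+1 < g.+1 by rewrite ltn_mod.
  rewrite {2}(divn_eq (N %/ g.+1) (g.+1 ^ n)) mulnDl addnAC -addnA.
  rewrite -mulnA [g.+1 ^ n * _]mulnC modnMDl.
  move: (g.+1 ^ n) (N %/ g.+1 %% g.+1 ^ n) (N %% g.+1) lt_m lt_r => q m r *.
  by rewrite modn_small; nia.
by rewrite -divn_eq.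
Qed.

Lemma from_digits_inj g s t :
  all (fun d => d < g) s -> all (fun d => d < g) t ->
  last 1 s != 0 -> last 1 t != 0 ->
  from_digits g s = from_digits g t -> s = t.
Proof.
have pos u : all (fun d => d < g) u -> u != [::] -> last 1 u != 0 ->
    0 < from_digits g u.
  elim: u => // d u IHu; rewrite from_digits_cons => /= /andP[ltd /IHu] H _ lu.
  case: u {IHu} lu H => [|e u] /= lu; first by lia.
  by move=> /(_ isT lu); nia.
elim: s t => [|d s IHs] [|e t] //.
- move=> _ At _ lt E; have := pos _ At isT lt.
  by rewrite -E /from_digits big_ord0.
- move=> As _ ls _ E; have := pos _ As isT ls.
  by rewrite E /from_digits big_ord0.
rewrite !from_digits_cons => /= /andP[ltd As] /andP[lte At] ls lt E.
have Ede : d = e.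
  by have := congr1 (modn^~ g) E; rewrite !(mulnC g) ![_ + _ * g]addnC
    !modnMDl !modn_small.
have Est : from_digits g s = from_digits g t.
  have g0 : 0 < g by lia.
  by move: E; rewrite Ede => /addnI /eqP; rewrite eqn_pmul2l // => /eqP.
rewrite Ede (IHs t) //.
  by case: (s) ls.
by case: (t) lt.
Qed.

Lemma digitsP g N s : 1 < g -> 0 < N -> reflect (s = digits g N) (is_expansion g N s).
Proof.
move=> g1 N0.
have /andP[leN ltN] := trunc_log_bounds g1 N0.
have Hd : is_expansion g N (digits g N).
  rewrite /is_expansion /digits (gtn_eqF N0) from_digits_mkseq.
  rewrite (@modn_small N) // eqxx andbT; apply/andP; split.
    by apply/allP => d /mapP[i _ ->]; rewrite ltn_mod; lia.
  have g0 e : 0 < g ^ e by rewrite expn_gt0; apply/orP; left; lia.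
  have lt_q : N %/ g ^ trunc_log g N < g by rewrite ltn_divLR // -expnS.
  by rewrite -nth_last size_mkseq nth_mkseq // modn_small // -lt0n divn_gt0.
apply: (iffP idP) => [|->] // /and3P[As ls /eqP Es].
move: Hd => /and3P[At lt /eqP Et].
have L u : last 0 u != 0 -> last 1 u != 0 by case: u.
by apply: (from_digits_inj As At); rewrite ?L // Es Et.
Qed.

(** * Reverse multiples *)

Definition reverse_multiple (g k N : nat) : bool :=
  (0 < N) && (k * N == from_digits g (rev (digits g N))).

(* A number of length [t] is below [g ^ t]. *)
Definition num_reverse_multiples (g k t : nat) : nat :=
  #|[set N : 'I_(g ^ t) | reverse_multiple g k N & base_length g N == t]|.

Fixpoint fib (n : nat) : nat :=
  if n is n1.+1 then if n1 is n2.+1 then fib n1 + fib n2 else 1 else 0.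

(* [s] has a maximal run of equal entries occupying positions
   [i, ..., i + l - 1]. *)
Definition maximal_run (s : seq nat) (i l : nat) : Prop :=
  [/\ 0 < l, i + l <= size s,
      forall j, i <= j < i + l -> nth 0 s j = nth 0 s i,
      0 < i -> nth 0 s i.-1 <> nth 0 s i
    & i + l < size s -> nth 0 s (i + l) <> nth 0 s i].

Definition no_single_digits (s : seq nat) : Prop :=
  forall i l, maximal_run s i l -> 1 < l.

(* A formal power series is its coefficient sequence.  [A / B] exists in the
   ring of formal power series when [B] has invertible constant term, and is
   then the only series whose Cauchy product with [B] is [A]. *)
Definition is_series_quotient (C : nat -> int) (A B : {poly int}) : Prop :=
  (B`_0)%R \is a GRing.unit /\
  forall n, (\sum_(i < n.+1) C i * B`_(n - i))%R = (A`_n)%R.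

(** * Young graphs *)

(* [Start] is [[[0,0]]] and [Node s r] is [[s,r]]. *)
Inductive node := Start | Node of nat & nat.

Definition option_of_node (x : node) : option (nat * nat) :=
  if x is Node s r then Some (s, r) else None.
Definition node_of_option (o : option (nat * nat)) : node :=
  if o is Some (s, r) then Node s r else Start.
Lemma option_of_nodeK : cancel option_of_node node_of_option.
Proof. by case. Qed.
HB.instance Definition _ := Equality.copy node (can_type option_of_nodeK).

Definition carries (x : node) : nat * nat :=
  if x is Node s r then (s, r) else (0, 0).

Definition edge (g k : nat) (x : node) (l : nat * nat) (y : node) : bool :=
  let: (s, r) := carries x in
  let: (c, a) := l in
  [&& c < g, a < g, k * a + r == c %[mod g],
      k * c <= a + s * g, a + s * g - k * c <= k - 1,
      (x == Start) ==> (a != 0) && (c != 0)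
    & y == Node (a + s * g - k * c) ((k * a + r - c) %/ g)].

(* An edge is determined by its endpoints (lemma [edge_label_inj]), so the
   unlabelled directed graph has no multiple edges. *)
Definition arrow (g k : nat) (x y : node) : Prop := exists l, edge g k x l y.

Lemma label_system_le k u v w z :
  1 < k -> k * u + v = k * w + z -> u + k * v = w + k * z -> z <= v.
Proof.
move=> k1 E E'; rewrite leqNgt; apply/negP => ltvz.
have Ez : z = v + (z - v) by rewrite subnKC // ltnW.
have d0 : 0 < z - v by rewrite subn_gt0.
move: (z - v) d0 Ez E E' => d d0 -> {ltvz z}; rewrite mulnDr => E E'.
have Eu : u = w + k * d.
  by apply/eqP; rewrite -(eqn_add2r (k * v)) E' addnA addnAC.
move/eqP: E; rewrite Eu mulnDr -addnA eqn_add2l addnC eqn_add2l => /eqP E.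
have lt1 : d < k * d by rewrite ltn_Pmull.
have lt2 : k * d < k * (k * d) by rewrite ltn_Pmull // (leq_ltn_trans _ lt1).
by move: (ltn_trans lt1 lt2); rewrite E ltnn.
Qed.

Lemma edge_label_inj g k x l l' y :
  1 < k -> edge g k x l y -> edge g k x l' y -> l = l'.
Proof.
case: l l' => [c a] [c' a'] k1; rewrite /edge; case: (carries x) => s r.
move=> /and5P[cg ag /eqP E1 L1 /and3P[_ _ /eqP ->]].
move=> /and5P[cg' ag' /eqP E2 L2 /and3P[_ _ /eqP[Es Er]]].
have D u v : v < g -> u = v %[mod g] -> u = (u - v) %/ g * g + v.
  move=> vg E; have Eu : u = u %/ g * g + v.
    by rewrite {1}(divn_eq u g) E (modn_small vg).
  by rewrite {2}Eu addnK mulnK // (leq_ltn_trans _ vg).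
have F1 := D _ _ cg E1; have F2 := D _ _ cg' E2.
rewrite -Er in F2; move: (_ %/ g) F1 F2 => q F1 F2.
clear D E1 E2 Er cg cg' ag ag'.
have Eac : k * a + c' = k * a' + c by lia.
have Eca : a + k * c' = a' + k * c by lia.
have Ec : c = c'.
  by apply/eqP; rewrite eqn_leq (label_system_le k1 Eac Eca)
    (label_system_le k1 (esym Eac) (esym Eca)).
by move: Eca; rewrite Ec => /addIn ->.
Qed.

Definition reaches (g k : nat) : node -> node -> Prop :=
  clos_refl_trans node (arrow g k).

Definition H_node (g k : nat) (x : node) : Prop := reaches g k Start x.

Definition even_pivot (g k : nat) (x : node) : Prop :=
  H_node g k x /\ exists r, x = Node r r.

Definition odd_pivot (g k : nat) (x : node) : Prop :=
  H_node g k x /\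
  ((exists r, x = Node r r /\ arrow g k x x) \/
   (exists r' r, [/\ r' <> r, x = Node r' r & arrow g k x (Node r r')])).

Definition pivot (g k : nat) (x : node) : Prop :=
  even_pivot g k x \/ odd_pivot g k x.

Definition young_graph_exists (g k : nat) : Prop :=
  (exists r, r <> 0 /\ H_node g k (Node r r)) \/
  (exists r' r, [/\ r' <> r, H_node g k (Node r' r)
                  & arrow g k (Node r' r) (Node r r')]).

Definition young_node (g k : nat) (x : node) : Prop :=
  H_node g k x /\ exists y, pivot g k y /\ reaches g k x y.

Definition young_edge (g k : nat) (x : node) (l : nat * nat) (y : node) : Prop :=
  [/\ young_node g k x, young_node g k y & edge g k x l y].

(* The nodes of the graph are the elements of [vertex] satisfying [in_graph]. *)
Record marked_graph := MarkedGraph {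
  vertex : Type;
  in_graph : vertex -> Prop;
  adjacent : vertex -> vertex -> Prop;
  starting : vertex;
  is_even : vertex -> Prop;
  is_odd : vertex -> Prop }.

Definition isomorphic (G G' : marked_graph) : Prop :=
  exists f : vertex G -> vertex G',
    [/\ forall x, in_graph x -> in_graph (f x),
        forall x y, in_graph x -> in_graph y -> f x = f y -> x = y
      & forall z, in_graph z -> exists x, in_graph x /\ f x = z] /\
    [/\ f (starting G) = starting G',
        forall x y, in_graph x -> in_graph y ->
          adjacent x y <-> adjacent (f x) (f y),
        forall x, in_graph x -> is_even x <-> is_even (f x)
      & forall x, in_graph x -> is_odd x <-> is_odd (f x)].

Definition young_graph (g k : nat) : marked_graph := {|
  vertex := node;
  in_graph := young_node g k;
  adjacent := fun x y => exists l, young_edge g k x l y;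
  starting := Start;
  is_even := even_pivot g k;
  is_odd := odd_pivot g k |}.

Inductive node1089 := S1089 | U1089 | V1089 | W1089 | X1089.

Definition adjacent1089 (x y : node1089) : Prop :=
  match x, y with
  | S1089, V1089 | U1089, U1089 | U1089, V1089 | V1089, W1089
  | W1089, W1089 | W1089, X1089 | X1089, U1089 => True
  | _, _ => False
  end.

Definition pivot1089 (x : node1089) : Prop := x = U1089 \/ x = W1089.

Definition graph1089 : marked_graph := {|
  vertex := node1089;
  in_graph := fun=> True;
  adjacent := adjacent1089;
  starting := S1089;
  is_even := pivot1089;
  is_odd := pivot1089 |}.

(* Main.v *)
(* When [g = (k + 1) b], the five nodes and seven edges of (i) always occur in
   the Young graph, so an isomorphism with the 1089 graph leaves room for no
   others. In that graph the carries are [k - 1] times bits, and every edge goes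
   from bits [(p, q)] to bits [(q, z)], where [q] differs from at most one of
   [p] and [z]; it reads the digit [k b z - q + b p]. Hence a reverse multiple
   is a bit string [beta] without single digits, palindromic because the walk is
   symmetric, and its digits are the coefficients of
   [(k b - x + b x ^ 2) * beta(x)]; at [x = g] the first factor is
   [b (g ^ 2 - 1)]. Half of such a palindrome ends at its centre with a repeated
   digit or with a change of digit after a repeated one, which yields the
   Fibonacci recurrence. *)

Require Import Defs.
From Stdlib Require Import Relation_Operators.
From mathcomp Require Import all_boot all_order all_algebra.
From mathcomp Require Import zify.

Set Implicit Arguments.
Unset Strict Implicit.

Import GRing.Theory.

(** * Edges and nodes forced by the 1089 isomorphism *)

(** Both carry equations are taken in additive form, so that neither truncated subtraction nor
    division has to be handled when an edge is exhibited. *)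
Lemma edge_intro g k x s r c a s' r' :
  carries x = (s, r) -> c < g -> a < g ->
  k * a + r = c + g * r' -> a + s * g = k * c + s' -> s' <= k - 1 ->
  (x = Start -> a != 0 /\ c != 0) ->
  edge g k x (c, a) (Node s' r').
Proof.
move=> Ex cg ag Er Es s'k hx; rewrite /edge Ex Er Es !addKn mulKn; last by lia.
rewrite cg ag [c + _]addnC [g * _]mulnC modnMDl leq_addr s'k !eqxx !andbT /=.
by apply/implyP=> /eqP/hx[-> ->].
Qed.

Definition node_of_1089 (k : nat) (z : node1089) : node :=
  match z with
  | S1089 => Start
  | U1089 => Node 0 0
  | V1089 => Node 0 (k - 1)
  | W1089 => Node (k - 1) (k - 1)
  | X1089 => Node (k - 1) 0
  end.

(** The default [(0, 0)] is the true label of the loop at [U1089]; on non-adjacent pairs the value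
    is immaterial. *)
Definition label_1089 (k b : nat) (z z' : node1089) : nat * nat :=
  match z, z' with
  | S1089, V1089 | U1089, V1089 => (b, k * b)
  | V1089, W1089 => (b - 1, k * b - 1)
  | W1089, W1089 => ((k + 1) * b - 1, (k + 1) * b - 1)
  | W1089, X1089 => (k * b - 1, b - 1)
  | X1089, U1089 => (k * b, b)
  | _, _ => (0, 0)
  end.

Lemma edge_1089 k b z z' : 1 < k -> 0 < b -> adjacent1089 z z' ->
  edge ((k + 1) * b) k (node_of_1089 k z) (label_1089 k b z z')
    (node_of_1089 k z').
Proof.
move=> k1 b0.
have [j ->] : exists j, k = j.+2 by exists (k - 2); lia.
have [c ->] : exists c, b = c.+1 by exists (b - 1); lia.
by case: z; case: z' => //= _; apply: edge_intro => //=; try nia;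
  move=> _; split; nia.
Qed.

(** The path S, V, W, X, U visits all five nodes and ends in the pivot [[0,0]], so each of them is
    reachable from the start and reaches a pivot. *)
Lemma young_node_of_1089 k b z : 1 < k -> 0 < b ->
  young_node ((k + 1) * b) k (node_of_1089 k z).
Proof.
move=> k1 b0; set g := (k + 1) * b.
have R u v : adjacent1089 u v -> reaches g k (node_of_1089 k u) (node_of_1089 k v).
  by move=> uv; apply: rt_step; exists (label_1089 k b u v); apply: edge_1089.
have SV := R S1089 V1089 I; have VW := R V1089 W1089 I.
have WX := R W1089 X1089 I; have XU := R X1089 U1089 I.
have SW := rt_trans _ _ _ _ _ SV VW.
have SX := rt_trans _ _ _ _ _ SW WX.
have SU := rt_trans _ _ _ _ _ SX XU.
have WU := rt_trans _ _ _ _ _ WX XU.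
have VU := rt_trans _ _ _ _ _ VW WU.
have H : H_node g k (node_of_1089 k z) by case: z => //; apply: rt_refl.
split=> //; exists (node_of_1089 k U1089); split.
  by left; split; last by exists 0.
by case: z {H} => //; apply: rt_refl.
Qed.

(** Follow S, V, W, X, U: out-neighbours in the 1089 graph are unique along this path except at W,
    whose loop is ruled out by injectivity since [k - 1] is nonzero. Thus [node_of_1089] is a right
    inverse of [f], and injectivity of [f] then leaves no further nodes. *)
Lemma node_of_1089_iso g k b f :
  1 < k -> 0 < b -> g = (k + 1) * b ->
  (forall x y, young_node g k x -> young_node g k y -> f x = f y -> x = y) ->
  f Start = S1089 ->
  (forall x y, young_node g k x -> young_node g k y ->
     (exists l, young_edge g k x l y) <-> adjacent1089 (f x) (f y)) ->
  forall z, f (node_of_1089 k z) = z.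
Proof.
move=> k1 b0 gE finj fS fadj.
have Y z : young_node g k (node_of_1089 k z).
  by rewrite gE; apply: young_node_of_1089.
have A z z' : adjacent1089 z z' ->
    adjacent1089 (f (node_of_1089 k z)) (f (node_of_1089 k z')).
  move=> zz'; apply/fadj => //; exists (label_1089 k b z z'); split=> //.
  by rewrite gE; apply: edge_1089.
have fV : f (node_of_1089 k V1089) = V1089.
  by move: (A S1089 V1089 I); rewrite /= fS; case: (f _).
have fW : f (node_of_1089 k W1089) = W1089.
  by move: (A V1089 W1089 I); rewrite fV; case: (f _).
have fX : f (node_of_1089 k X1089) = X1089.
  move: (A W1089 X1089 I); rewrite fW.
  case E: (f (node_of_1089 k X1089)) => //.
  by have [] : node_of_1089 k X1089 = node_of_1089 k W1089;
    [apply: finj; rewrite ?fW | lia].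
have fU : f (node_of_1089 k U1089) = U1089.
  by move: (A X1089 U1089 I); rewrite fX; case: (f _).
by case.
Qed.

Definition young_edges_1089 (k b : nat) : seq (node * (nat * nat) * node) :=
  [:: (Start, (b, k * b), Node 0 (k - 1));
      (Node 0 0, (0, 0), Node 0 0);
      (Node 0 0, (b, k * b), Node 0 (k - 1));
      (Node 0 (k - 1), (b - 1, k * b - 1), Node (k - 1) (k - 1));
      (Node (k - 1) (k - 1), ((k + 1) * b - 1, (k + 1) * b - 1),
         Node (k - 1) (k - 1));
      (Node (k - 1) (k - 1), (k * b - 1, b - 1), Node (k - 1) 0);
      (Node (k - 1) 0, (k * b, b), Node 0 0)].

Lemma young_graph_1089 g k b :
  1 < k -> 0 < b -> g = (k + 1) * b ->
  isomorphic (young_graph g k) graph1089 ->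
  [/\ forall x, young_node g k x <->
        x \in [:: Start; Node 0 0; Node 0 (k - 1);
                  Node (k - 1) (k - 1); Node (k - 1) 0],
      forall x l y, young_edge g k x l y <-> (x, l, y) \in young_edges_1089 k b
    & forall x, pivot g k x <-> x \in [:: Node 0 0; Node (k - 1) (k - 1)]].
Proof.
move=> k1 b0 gE [f [[/= _ finj _] [/= fS fadj fev fodd]]].
have fK := node_of_1089_iso k1 b0 gE finj fS fadj.
have Y z : young_node g k (node_of_1089 k z).
  by rewrite gE; apply: young_node_of_1089.
have nodeK x : young_node g k x -> x = node_of_1089 k (f x).
  by move=> Yx; apply: finj; rewrite ?fK.
have Ed z z' : adjacent1089 z z' -> young_edge g k (node_of_1089 k z)
    (label_1089 k b z z') (node_of_1089 k z').
  by move=> zz'; split=> //; rewrite gE; apply: edge_1089.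
split=> [x|x l y|x].
- split=> [/nodeK->|]; first by case: (f x); rewrite !inE eqxx ?orbT.
  rewrite !inE => /orP[|/orP[|/orP[|/orP[]]]] /eqP->.
  + exact: (Y S1089).
  + exact: (Y U1089).
  + exact: (Y V1089).
  + exact: (Y W1089).
  + exact: (Y X1089).
- split=> [E|].
    have [Yx Yy exy] := E.
    have adj : adjacent1089 (f x) (f y) by apply/fadj => //; exists l.
    (* The listed edge has the same endpoints, so the label is the listed one. *)
    have [_ _] := Ed _ _ adj; rewrite -!nodeK // => /(edge_label_inj k1 exy) ->.
    rewrite (nodeK x) // (nodeK y) // !fK.
    by case: (f x) (f y) adj => [] [] //= _; rewrite !inE eqxx ?orbT.
  rewrite !inE => /orP[|/orP[|/orP[|/orP[|/orP[|/orP[]]]]]] /eqP[-> -> ->].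
  + exact: (Ed S1089 V1089).
  + exact: (Ed U1089 U1089).
  + exact: (Ed U1089 V1089).
  + exact: (Ed V1089 W1089).
  + exact: (Ed W1089 W1089).
  + exact: (Ed W1089 X1089).
  + exact: (Ed X1089 U1089).
split=> [Px|].
  have Yx : young_node g k x.
    by split; [case: Px => [[]|[]] | exists x; split=> //; apply: rt_refl].
  have fx : pivot1089 (f x) by case: Px => [/(fev _ Yx)|/(fodd _ Yx)].
  by rewrite (nodeK _ Yx); case: fx => ->; rewrite !inE eqxx ?orbT.
rewrite !inE => /orP[] /eqP->; left.
  by apply/(fev _ (Y U1089)); rewrite fK; left.
by apply/(fev _ (Y W1089)); rewrite fK; right.
Qed.

(** * Admissible words with zero padding *)

(* The word [beta] preceded and followed by zeros; the two leading zeros make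
   [padded s j] and [padded s j.+1] the carry bits of the [j]-th node of the
   path of [gamma * beta]. *)
Definition padded (s : seq nat) (j : nat) : nat := nth 0 [:: 0, 0 & s] j.

(** These are the digit words of the [beta] in the statement. Thanks to the padding, one local
    condition forbids single digits at the ends as well as inside; [last 0 s = 1] also excludes the
    empty word. *)
Definition admissible (s : seq nat) : Prop :=
  [/\ all (fun d => d < 2) s, rev s = s, last 0 s = 1
    & forall j, padded s j.+1 = padded s j \/ padded s j.+1 = padded s j.+2].

Lemma padded_lt2 s j : all (fun d => d < 2) s -> padded s j < 2.
Proof.
move=> As; case: j => [|[|j]] //; rewrite /padded /=.
by have [ltj|?] := ltnP j (size s); [exact: (all_nthP 0 As) | rewrite nth_default].
Qed.

Lemma padded_end s j : size s + 2 <= j -> padded s j = 0.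
Proof. by move=> lej; rewrite /padded nth_default //=; lia. Qed.

(** With two zeros on either side the word has length [size s + 4] and is still a palindrome. *)
Lemma padded_rev s j : rev s = s -> j <= size s + 3 ->
  padded s (size s + 3 - j) = padded s j.
Proof.
move=> Rs; case: j => [|[|j]] lej; [by rewrite padded_end //; lia.. |].
have [ltj|leS] := ltnP j (size s); last first.
  rewrite (@padded_end _ j.+2); last by lia.
  by case E: (_ - _) => [|[|i]] //; lia.
have -> : size s + 3 - j.+2 = (size s - j.+1).+2 by lia.
by rewrite /padded /= -{1}Rs nth_rev; [congr (nth 0 s _); lia | lia].
Qed.

Lemma admissible_last s : admissible s -> padded s (size s + 1) = 1.
Proof.
case=> _ _ ls _; case: s ls => //= d s ls.
by rewrite addn1 /padded /= -[size s]/(size (d :: s)).-1 nth_last.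
Qed.

Lemma admissible_size s : admissible s -> 1 < size s.
Proof.
case=> _ _ ls ns; case: s ls ns => [|d [|//]] //= -> /(_ 1).
by rewrite /padded /= => -[].
Qed.

(** * From admissible words to reverse multiples *)

(** The three shifts of the padded word have values [E], [g * E] and [g ^ 2 * E], so the sum is
    [(k b - g + b g ^ 2) E], and [g = k b + b]. *)
Lemma gamma_product g k b s (a : nat -> nat) :
  g = (k + 1) * b -> 0 < b ->
  (forall j, j < size s + 2 ->
     a j + padded s j.+1 = k * b * padded s j.+2 + b * padded s j) ->
  \sum_(j < size s + 2) a j * g ^ j = b * (g ^ 2 - 1) * from_digits g s.
Proof.
move=> gE b0 aE; set E := from_digits g s.
have E2 : \sum_(j < size s + 2) padded s j.+2 * g ^ j = E.
  by rewrite addn2 !big_ord_recr /= !padded_end; [rewrite !addn0 | lia | lia].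
have E1 : \sum_(j < size s + 2) padded s j.+1 * g ^ j = g * E.
  have eE : padded s (size s).+2 = 0 by rewrite padded_end ?addn2.
  rewrite addn2 big_ord_recl big_ord_recr /= /bump /= add1n eE !mul0n add0n addn0.
  rewrite /E /from_digits big_distrr /=.
  by apply: eq_bigr => i _; rewrite /bump /= add1n expnS mulnCA.
have E0 : \sum_(j < size s + 2) padded s j * g ^ j = g ^ 2 * E.
  rewrite addn2 !big_ord_recl /= /E /from_digits big_distrr /=.
  by apply: eq_bigr => i _; rewrite /bump /= !add1n -[i.+2]add2n expnD mulnCA.
have : \sum_(j < size s + 2) a j * g ^ j + g * E =
       k * b * E + b * (g ^ 2 * E).
  rewrite -E1 -E0 -[in k * b * E]E2 !big_distrr -!big_split /=.
  by apply: eq_bigr => j _; rewrite -mulnDl aE // mulnDl !mulnA.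
have : g ^ 2 = (g ^ 2 - 1) + 1 by rewrite subnK // expn_gt0; lia.
move: (\sum_(_ < _) _) (g ^ 2 - 1) (g ^ 2) => A q g2 -> H.
have : g * E = k * b * E + b * E by rewrite gE; lia.
by lia.
Qed.

(** Weight the [j]-th equation by [g ^ j] and add: all inner carries [r * e j] cancel. *)
Lemma carry_telescope g k r (a c e : nat -> nat) n :
  (forall j, j < n -> k * a j + r * e j = c j + g * (r * e j.+1)) ->
  k * (\sum_(j < n) a j * g ^ j) + r * e 0 =
  \sum_(j < n) c j * g ^ j + g ^ n * (r * e n).
Proof.
elim: n => [|n IHn] H; first by rewrite !big_ord0; lia.
rewrite !big_ord_recr /= mulnDr.
have := IHn (fun j jn => H j (ltnW jn)); have := H n (ltnSn n).
move: (\sum_(j < n) _) (\sum_(j < n) _) => A C; rewrite expnS.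
move: (g ^ n) => q; nia.
Qed.

Lemma from_digits_gt0 g s : 0 < g -> last 0 s != 0 -> 0 < from_digits g s.
Proof.
move=> g0; elim: s => //= d [|d' s] IHs; rewrite from_digits_cons /= => ls.
  by lia.
by have := IHs ls; nia.
Qed.

Lemma from_digits_mkseq_sum g (a : nat -> nat) n :
  from_digits g (mkseq a n) = \sum_(j < n) a j * g ^ j.
Proof.
rewrite /from_digits size_mkseq; apply: eq_bigr => j _.
by rewrite nth_mkseq.
Qed.

Lemma rev_mkseq (a : nat -> nat) n :
  rev (mkseq a n) = mkseq (fun j => a (n - j.+1)) n.
Proof.
apply: (@eq_from_nth _ 0) => [|i]; rewrite size_rev !size_mkseq // => ltin.
by rewrite nth_rev size_mkseq // !nth_mkseq //; lia.
Qed.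

Lemma admissible_reverse_multiple g k b s :
  1 < k -> 0 < b -> g = (k + 1) * b -> admissible s ->
  reverse_multiple g k (b * (g ^ 2 - 1) * from_digits g s) /\
  base_length g (b * (g ^ 2 - 1) * from_digits g s) = size s + 2.
Proof.
move=> k1 b0 gE ads; have [As Rs ls ns] := ads.
set n := size s + 2; set e := padded s.
have e2 j : e j < 2 by apply: padded_lt2.
have kb : b <= k * b by rewrite leq_pmull // ltnW.
have gkb : g = k * b + b by rewrite gE; lia.
(* The run condition makes this a digit. A middle bit 1 has a neighbouring 1, so the subtraction is
   not truncated; two outer 1's force a middle 1, so the value is at most [g - 1]. *)
pose a j := k * b * e j.+2 + b * e j - e j.+1.
have aE j : a j + e j.+1 = k * b * e j.+2 + b * e j.
  by rewrite /a subnK //; case: (ns j); rewrite -/e;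
    move: (e2 j) (e2 j.+1) (e2 j.+2); move: (e j) (e j.+1) (e j.+2) => x y z; nia.
have ag j : a j < g.
  by rewrite /a; case: (ns j); rewrite -/e;
    move: (e2 j) (e2 j.+1) (e2 j.+2); move: (e j) (e j.+1) (e j.+2) => x y z; nia.
have eR j : j < n -> e (n - j.+1) = e j.+2 /\ e (n - j.+1).+1 = e j.+1
    /\ e (n - j.+1).+2 = e j.
  rewrite /e /n => jn; rewrite -(@padded_rev s j) // -1?(@padded_rev s j.+1) //;
    rewrite -1?(@padded_rev s j.+2) //; try lia.
  by do !split; congr (padded s _); lia.
have NE := gamma_product gE b0 (fun j _ => aE j); rewrite -/n in NE.
have /and3P[_ l0 /eqP ND] :
    is_expansion g (b * (g ^ 2 - 1) * from_digits g s) (mkseq a n).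
  rewrite /is_expansion from_digits_mkseq_sum NE eqxx andbT.
  apply/andP; split; first by apply/allP => d /mapP[j _ ->].
  (* The leading digit is [b]: of its three bits only the last digit of [s] is nonzero. *)
  rewrite -nth_last size_mkseq nth_mkseq; last by rewrite /n addn2.
  rewrite {1}/n addn2 /= /a /e; have := admissible_last ads; rewrite addn1 => ->.
  by rewrite !padded_end; lia.
set N := b * _ * _ in NE ND *.
have N0 : 0 < N.
  rewrite /N !muln_gt0 b0 subn_gt0 /=; apply/andP; split; first by rewrite expnS; nia.
  by apply: from_digits_gt0; [nia | rewrite ls].
have dN : mkseq a n = digits g N.
  apply/digitsP => //; first by nia.
  rewrite /is_expansion l0 ND eqxx !andbT.
  by apply/allP => d /mapP[j _ ->].
rewrite /reverse_multiple /base_length N0 -dN size_mkseq; split=> //.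
rewrite rev_mkseq from_digits_mkseq_sum -NE.
(* The carries are [k - 1] times the bits and vanish at both ends. Reflecting [j] swaps the outer
   bits in the digit formula, and each carry equation then reduces to
   [g * (k - 1) + b = k ^ 2 * b]. *)
have := @carry_telescope g k (k - 1) a (fun j => a (n - j.+1)) (fun j => e j.+1) n.
have -> : e n.+1 = 0 by rewrite /e padded_end // /n; lia.
rewrite -[e 1]/0 !muln0 !addn0 => H; rewrite H ?eqxx // {H} => j jn.
have := aE (n - j.+1); have := aE j; have [-> [-> ->]] := eR j jn.
rewrite gkb; have [i ->] : exists i, k = i.+2 by exists (k - 2); lia.
move: (a j) (a (n - j.+1)) (e j) (e j.+1) (e j.+2) => a1 a2 x y z.
by move=> H1 H2; have := congr1 (muln i.+2) H1; have -> : i.+2 - 1 = i.+1; lia.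
Qed.

(** * From reverse multiples to admissible words *)

(** Schoolbook multiplication by [k], with arbitrary incoming and outgoing carries so that the
    induction on the digits goes through. Carries stay below [k] because
    [k * (g - 1) + (k - 1) < k * g]. *)
Lemma multiplication_carries g k (a c : seq nat) r0 R :
  size a = size c -> all (fun d => d < g) a -> all (fun d => d < g) c ->
  r0 < k -> k * from_digits g a + r0 = from_digits g c + g ^ size a * R ->
  exists r : nat -> nat,
    [/\ r 0 = r0, r (size a) = R, forall i, i <= size a -> r i < k
      & forall i, i < size a ->
          k * nth 0 a i + r i = nth 0 c i + g * r i.+1].
Proof.
elim: a c r0 => [|x a IHa] [|y c] r0 //=.
  rewrite /from_digits !big_ord0 muln0 expn0 mul1n !add0n => _ _ _ r0k E.
  by exists (fun=> R); split=> // i _; rewrite -E.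
move=> [Esz] /andP[xg aa] /andP[yg ac] r0k; rewrite !from_digits_cons expnS => E.
have g0 : 0 < g by lia.
have Ey : (k * x + r0) %% g = y.
  have E' : k * from_digits g a * g + (k * x + r0) =
      (from_digits g c + g ^ size a * R) * g + y by lia.
  by have := congr1 (modn^~ g) E'; rewrite !modnMDl (modn_small yg).
have Ex := divn_eq (k * x + r0) g; rewrite Ey in Ex.
set r1 := (k * x + r0) %/ g in Ex *.
have r1k : r1 < k by rewrite ltn_divLR //; nia.
have [|r [h0 hn hk he]] := IHa c r1 Esz aa ac r1k.
  apply/eqP; rewrite -(eqn_pmul2l g0) -(eqn_add2l y); apply/eqP.
  by move: (from_digits g a) (from_digits g c) (g ^ size a) E Ex => A C G; lia.
exists (fun i => if i is i'.+1 then r i' else r0); split=> //.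
  by case=> // i; apply: hk.
by case=> [|i] /= lti; [rewrite h0; lia | apply: he].
Qed.

Lemma reverse_multiple_carries g k N : 1 < g -> 0 < k -> reverse_multiple g k N ->
  let n := base_length g N in let a := nth 0 (digits g N) in
  exists r : nat -> nat,
    [/\ r 0 = 0, r n = 0, forall i, i <= n -> r i < k
      & forall i, i < n -> k * a i + r i = a (n - i.+1) + g * r i.+1].
Proof.
move=> g1 k0 /andP[N0 /eqP kN].
have /and3P[ad _ /eqP fd] : is_expansion g N (digits g N) by apply/digitsP.
have [|||||r [r0 rn rk rE]] :=
  @multiplication_carries g k (digits g N) (rev (digits g N)) 0 0.
- by rewrite size_rev.
- by [].
- by rewrite all_rev.
- by [].
- by rewrite fd kN muln0 !addn0.
exists r; split=> // i ltin.
by rewrite rE // nth_rev.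
Qed.

(** In the 1089 graph a carry is 0 or [k - 1], and this is its quotient by [k - 1]. *)
Definition bit (r : nat) : nat := r != 0.

(** Read off from the seven edges. The overlap [s' = r] turns a path of carry pairs into a single
    sequence of bits. *)
Lemma young_edges_1089_carries k b x c a s' r' : 1 < k -> 0 < b ->
  (x, (c, a), Node s' r') \in young_edges_1089 k b ->
  let: (s, r) := carries x in
  [/\ s' = r, bit r = bit s \/ bit r = bit r',
      a + bit r = k * b * bit r' + b * bit s & x = Start -> r' != 0].
Proof.
move=> k1 b0; have [j ->] : exists j, k = j.+2 by exists (k - 2); lia.
rewrite !inE.
by do 6?[case/orP]; move/eqP => [-> _ -> -> ->] /=; split=> //; rewrite /bit /=;
  try (by [left | right]); nia.
Qed.

(* Reading [N] from both ends at once walks through the nodes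
   [[r_(n-j), r_j]], where [r_i] are the carries of the multiplication [k * N].
   The walk ends in the pivot [[0,0]], hence stays inside the Young graph. *)
Lemma reverse_multiple_young_path g k N (r : nat -> nat) :
  1 < g -> reverse_multiple g k N ->
  let n := base_length g N in let a := nth 0 (digits g N) in
  let P j := if j is 0 then Start else Node (r (n - j)) (r j) in
  r 0 = 0 -> r n = 0 -> (forall i, i <= n -> r i < k) ->
  (forall i, i < n -> k * a i + r i = a (n - i.+1) + g * r i.+1) ->
  forall j, j < n -> young_edge g k (P j) (a (n - j.+1), a j) (P j.+1).
Proof.
move=> g1 /andP[N0 _] n a P r0 rn rk rE.
have /and3P[ad la _] : is_expansion g N (digits g N) by apply/digitsP.
have n0 : 0 < n by rewrite /n /base_length; case: (digits g N) la.
have ag j : j < n -> a j < g by move=> jn; apply: (all_nthP 0 ad).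
have an : a n.-1 != 0 by rewrite /a nth_last.
have EP j : j < n -> edge g k (P j) (a (n - j.+1), a j) (P j.+1).
  move=> jn; have := rE _ jn; have ltr : n - j.+1 < n by lia.
  have := rE _ ltr; have -> : n - (n - j.+1).+1 = j by lia.
  have -> : (n - j.+1).+1 = n - j by lia.
  move=> E1 E2; apply: (@edge_intro _ _ _ (r (n - j)) (r j)).
  - by case: (j) => //=; rewrite subn0 r0 rn.
  - exact: ag.
  - exact: ag.
  - exact: E2.
  - by rewrite mulnC addnC [r (n - j) * g]mulnC in E1 *; lia.
  - by have := rk (n - j.+1); lia.
  (* Only the edge out of [Start] needs nonzero digits: the leading digit is nonzero, and the lowest
     digit is at least [k] times it because [r n = 0]. *)
  - case: j jn E1 {E2 ltr} => // jn; rewrite subn0 rn subn1 => E1 _.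
    split=> //; have := rk n; move/eqP: an; nia.
have RP i j : i <= j -> j <= n -> reaches g k (P i) (P j).
  elim: j => [|j IHj]; first by rewrite leqn0 => /eqP -> _; apply: rt_refl.
  rewrite leq_eqVlt => /orP[/eqP-> _|]; first exact: rt_refl.
  move=> leij ltjn; apply: (rt_trans _ _ _ (P j)); first exact: IHj (ltnW ltjn).
  by apply: rt_step; exists (a (n - j.+1), a j); apply: EP.
have PnE : P n = Node 0 0 by rewrite /P; case: (n) n0 rn => // m _ ->; rewrite subnn r0.
have Y j : j <= n -> young_node g k (P j).
  move=> jn; split; first exact: (RP 0 j).
  exists (P n); split; last exact: RP.
  by left; split; [exact: (RP 0 n) | exists 0].
by move=> j jn; split; [apply: Y; apply: ltnW | apply: Y | apply: EP].
Qed.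

Lemma reverse_multiple_admissible g k b N :
  1 < k -> 0 < b -> g = (k + 1) * b ->
  (forall x l y, young_edge g k x l y -> (x, l, y) \in young_edges_1089 k b) ->
  reverse_multiple g k N ->
  exists s, [/\ admissible s, size s + 2 = base_length g N
              & N = b * (g ^ 2 - 1) * from_digits g s].
Proof.
move=> k1 b0 gE listed rmN; have g1 : 1 < g by nia.
have [r [r0 rn rk rE]] := reverse_multiple_carries g1 (ltnW k1) rmN.
have := reverse_multiple_young_path g1 rmN r0 rn rk rE.
have /andP[N0 _] := rmN.
have /and3P[_ la /eqP fd] : is_expansion g N (digits g N) by apply/digitsP.
have n0 : 0 < base_length g N by rewrite /base_length; case: (digits g N) la.
have fdE : N = \sum_(i < base_length g N) nth 0 (digits g N) i * g ^ i by rewrite -{1}fd.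
move: (base_length g N) (nth 0 (digits g N)) r0 rn n0 fdE {rk rE la fd}
  => n a r0 rn n0 fdE EP.
have F j : j < n -> [/\ r (n - j.+1) = r j,
    bit (r j) = bit (r (n - j)) \/ bit (r j) = bit (r j.+1),
    a j + bit (r j) = k * b * bit (r j.+1) + b * bit (r (n - j))
  & j = 0 -> r j.+1 != 0].
  move=> jn; have := young_edges_1089_carries k1 b0 (listed _ _ _ (EP j jn)).
  case: j jn => [|j] jn /= [H1 H2 H3 H4]; last by split.
  by rewrite subn0 r0 rn; split=> // _; apply: H4.
(* The first edge gives [r 1 != 0] and [r (n - 1) = r 0 = 0], while [r n = 0]. *)
have n2 : 2 < n.
  have [R1 _ _ /(_ erefl)] := F 0 n0.
  case: n n0 rn R1 {F EP fdE} => [|[|[|n]]] // _; first by move=> ->.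
  by rewrite /= r0 => _ ->.
(* Carries 0, [n - 1] and [n] vanish and become padding; the word consists of the bits of the
   others. *)
pose s := mkseq (fun j => bit (r j.+1)) (n - 2).
have sz : size s + 2 = n by rewrite size_mkseq subnK // ltnW.
have R1 : r n.-1 = 0 by have [] := F 0 n0; rewrite r0 subn1.
have pS j : j <= n -> padded s j.+1 = bit (r j).
  case: j => [|j] jn; first by rewrite r0.
  have [ltj|lej] := ltnP j (n - 2); first by rewrite /padded /= nth_mkseq.
  rewrite padded_end; last by lia.
  have : j.+1 = n.-1 \/ j.+1 = n by lia.
  by case=> ->; rewrite ?R1 ?rn.
(* The symmetry of the carries identifies the first entry of each node with the padded word one
   place earlier. *)
have p0 j : j <= n -> padded s j = bit (r (n - j)).
  case: j => [|j] jn; first by rewrite subn0 rn.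
  by rewrite pS ?(ltnW jn) //; have [->] := F j jn.
exists s; split=> //.
  split.
  - by apply/allP => d /mapP[j _ ->]; rewrite /bit; case: (r _ != 0).
  - rewrite rev_mkseq; apply/eq_in_map => j; rewrite mem_iota => /andP[_ jn].
    have /F[<- _ _ _] : j.+1 < n by lia.
    by congr (bit (r _)); lia.
  - rewrite -nth_last size_mkseq nth_mkseq; last by lia.
    have [_ _ _ /(_ erefl)] := F 0 n0; rewrite /bit.
    have /F[<- _ _ _] : 1 < n by lia.
    by have -> : n - 2 = (n - 2).-1.+1 by [lia]; move=> /= ->.
  - move=> j; have [jn|nj] := ltnP j n; last by right; rewrite !padded_end //; lia.
    have [_ ns _ _] := F j jn.
    by rewrite (p0 j) ?(ltnW jn) // !pS // ltnW.
rewrite {1}fdE -sz; apply: (gamma_product gE b0) => j; rewrite sz => jn.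
by have [_ _ aE _] := F j jn; rewrite (p0 j) ?(ltnW jn) // !pS // ltnW.
Qed.

(** * Run condition and digit expansions *)

(** A failure of the local condition is a maximal run of length 1. Conversely such a run at an end
    cannot be excused by the padding, since a palindrome with nonzero last digit also has nonzero
    first digit. *)
Lemma no_single_digits_padded s : rev s = s -> last 0 s != 0 ->
  no_single_digits s <->
  forall j, padded s j.+1 = padded s j \/ padded s j.+1 = padded s j.+2.
Proof.
move=> Rs ls; split=> [ns [|j]|H i l [l0 lesz _ hL hR]].
- by left.
- have [ltj|lej] := ltnP j (size s); last first.
    by right; rewrite /padded /= !nth_default // ltnW.
  have [e1|n1] := eqVneq (padded s j.+2) (padded s j.+1); first by left.
  have [e2|n2] := eqVneq (padded s j.+2) (padded s j.+3); first by right.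
  suff /ns : maximal_run s j 1 by [].
  split=> //; rewrite ?addn1 //.
  + by move=> i ji; congr (nth 0 s _); lia.
  + by move: n1; case: (j) => //= i /eqP n1 _ /esym.
  + by move=> _ /esym/eqP; rewrite -[_ == _]/(padded s j.+2 == padded s j.+3) (negbTE n2).
have [//|l1] := ltnP 1 l; have {l0 l1} El : l = 1 by lia.
subst l; rewrite addn1 in lesz hR.
have := H i.+1; rewrite /padded /= => -[] E.
  case: i lesz hL E {hR} => [|i] lesz hL /= E; last by case: (hL isT).
  by move: ls; rewrite -nth_last -{1}Rs nth_rev ?prednK // subnn E.
have [lt|le] := ltnP i.+1 (size s); first by case: (hR lt).
have Ei : i = (size s).-1 by lia.
by move: ls; rewrite -nth_last -Ei E nth_default.
Qed.

Lemma digits_admissible g s : 1 < g -> admissible s ->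
  digits g (from_digits g s) = s.
Proof.
move=> g1 [As _ ls _]; apply/esym/digitsP => //.
  by apply: from_digits_gt0; [apply: ltnW | rewrite ls].
rewrite /is_expansion ls eqxx !andbT; apply: sub_all As => d.
by move/leq_trans; apply.
Qed.

Lemma admissible_digitsP g beta : 1 < g ->
  [/\ 0 < beta, rev (digits g beta) = digits g beta,
      {subset digits g beta <= [:: 0; 1]} & no_single_digits (digits g beta)] <->
  admissible (digits g beta) /\ beta = from_digits g (digits g beta).
Proof.
move=> g1; split=> [[b0 Rs sub ns]|[ads Eb]].
  have /and3P[_ ls /eqP fd] : is_expansion g beta (digits g beta) by apply/digitsP.
  split=> //; split=> //.
  - by apply/allP => d /sub; rewrite !inE => /orP[] /eqP->.
  - have : last 0 (digits g beta) \in digits g beta.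
      by case: (digits g beta) ls => //= d s _; apply: mem_last.
    by move/sub; rewrite !inE (negbTE ls) => /eqP.
  - exact/no_single_digits_padded.
have [As Rs ls ns] := ads; split=> //.
- by rewrite Eb; apply: from_digits_gt0; [apply: ltnW | rewrite ls].
- by move=> d /(allP As); rewrite !inE; case: d => [|[]].
- by apply/no_single_digits_padded; rewrite ?ls.
Qed.

(** * Counting admissible palindromes by halves *)

(** [stay] and [turn] extend a half towards the centre. Before changing the digit, [turn] repeats
    the old one, so that no single digit is left behind. *)
Definition stay (w : seq nat) : seq nat := head 0 w :: w.
Definition turn (w : seq nat) : seq nat := (1 - head 0 w) :: stay w.

(* Halves of admissible palindromes, innermost digit first. The innermost run
   may be a single digit, since it is doubled in the palindrome. *)
Fixpoint half_words (h : nat) : seq (seq nat) :=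
  if h is h1.+1 then
    if h1 is h2.+1 then map stay (half_words h1) ++ map turn (half_words h2)
    else [:: [:: 1]]
  else [::].

Lemma size_half_words h : size (half_words h) = fib h.
Proof.
elim/ltn_ind: h => -[|[|h]] IH //.
rewrite [half_words _]/(map stay (half_words h.+1) ++ map turn (half_words h)).
by rewrite size_cat !size_map !IH.
Qed.

(** Words from [stay] and from [turn] differ in whether their first two digits agree. *)
Lemma half_words_uniq h : uniq (half_words h).
Proof.
elim/ltn_ind: h => -[|[|h]] IH //.
rewrite [half_words _]/(map stay (half_words h.+1) ++ map turn (half_words h)).
have stay_inj : injective stay by move=> w w' [].
have turn_inj : injective turn by move=> w w' [].
rewrite cat_uniq (map_inj_uniq stay_inj) (map_inj_uniq turn_inj) !IH // andbT /=.
apply/hasPn => w /mapP[w' _ ->]; apply/mapP => -[v _] [E Ev].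
by move: E; rewrite -Ev /=; lia.
Qed.

(** Peel off the centre: if the first two digits agree the word is a [stay]; otherwise the second
    and third must agree and it is a [turn]. The default 0 past the end acts as the outer
    padding. *)
Lemma half_wordsP h (w : seq nat) :
  (w \in half_words h) <->
  [/\ size w = h, all (fun d => d < 2) w, last 0 w = 1
    & forall j, nth 0 w j.+1 = nth 0 w j \/ nth 0 w j.+1 = nth 0 w j.+2].
Proof.
elim/ltn_ind: h w => -[|[|h]] IH w.
- by rewrite in_nil; split=> // -[/size0nil->].
- rewrite inE; split=> [/eqP->|[]].
    by split=> // -[|[|j]]; right.
  by case: w => [|d [|//]] //= _ _ ->.
rewrite [half_words _]/(map stay (half_words h.+1) ++ map turn (half_words h)).
rewrite mem_cat; split.
  case/orP=> /mapP[v /IH[] // sv av lv nv ->].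
    case: v sv av lv nv => //= x v [sv] /andP[x2 av] lv nv.
    split=> //=; rewrite ?sv ?x2 //; case=> [|j]; first by left.
    exact: nv.
  case: v sv av lv nv => //= x v sv /andP[x2 av] lv nv.
  split=> //=; rewrite ?sv ?x2 ?av //; first by rewrite !andbT; lia.
  case=> [|[|j]]; [by right | by left | exact: nv].
case: w => [|x [|y w]] [] //= [sw] /and3P[x2 y2 aw] lw nw.
have [exy|nxy] := eqVneq x y.
  apply/orP; left; apply/mapP; exists (y :: w); last by rewrite exy.
  apply/(IH _ (ltnSn _)); split=> //=; [by rewrite sw | by rewrite y2 | ].
  by move=> j; apply: (nw j.+1).
apply/orP; right; apply/mapP.
have /= := nw 0 => -[/esym/eqP|]; first by rewrite (negbTE nxy).
(* With only two digits, the outer one would equal the default 0, yet it is 1. *)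
case: w sw aw lw nw => [|z w] /= sw aw lw nw yz; first by rewrite yz in lw.
exists (y :: w); last by rewrite /turn /stay /= -yz; congr (_ :: _); lia.
apply/(IH h (leqnSn _)); split=> //=; rewrite ?yz //.
by move=> j; apply: (nw j.+2).
Qed.

(** [o] is the parity of the length. The centre of an odd palindrome has equal neighbours, so it
    must repeat them. *)
Definition mirror (o : nat) (w : seq nat) : seq nat :=
  rev w ++ nseq o (head 0 w) ++ w.

Lemma size_mirror o w : size (mirror o w) = size w * 2 + o.
Proof. by rewrite /mirror !size_cat size_rev size_nseq; lia. Qed.

Lemma mirror_admissible h o (w : seq nat) : o <= 1 ->
  w \in half_words h -> admissible (mirror o w).
Proof.
move=> o1 /half_wordsP[sw aw lw nw]; set s := mirror o w.
have Rs : rev s = s by rewrite /s /mirror !rev_cat revK rev_nseq catA.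
have h0 : 0 < size w by case: (w) lw.
have eW j : size w + o + 2 <= j -> padded s j = nth 0 w (j - (size w + o + 2)).
  move=> lej; have -> : j = (j - 2).+2 by lia.
  have l1 : size w <= j - 2 by lia.
  have l2 : o <= j - 2 - size w by lia.
  rewrite /padded /= /s /mirror nth_cat size_rev ltnNge l1 /=.
  rewrite nth_cat size_nseq ltnNge l2 /=; congr (nth 0 w _); lia.
have eM j : size w < j <= size w + o + 2 -> padded s j = head 0 w.
  move=> /andP[lt le]; have [lej|ltj] := leqP (size w + o + 2) j.
    by rewrite eW // -nth0; congr (nth 0 w _); lia.
  have [ej|nj] := eqVneq j (size w).+1.
    rewrite -padded_rev //; last by rewrite size_mirror; lia.
    by rewrite size_mirror eW -?nth0; [congr (nth 0 w _); lia | lia].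
  have ej : j = (size w).+2 by lia.
  have eo : o = 1 by lia.
  by rewrite ej /padded /s /mirror /= nth_cat size_rev ltnn subnn eo.
split=> //.
- rewrite !all_cat all_rev aw all_nseq andbT /=.
  by case: (w) h0 aw => //= x v _ /andP[-> _]; rewrite orbT.
- by rewrite /s /mirror catA last_cat; case: (w) h0 lw.
(* Outside the centre the condition comes from [w], on the left after reflection; near the centre
   the digits are constant. *)
move=> j; have [ltj|lej] := ltnP j (size w).
  have sz : size s = size w * 2 + o by rewrite size_mirror.
  rewrite -(@padded_rev s j) -1?(@padded_rev s j.+1) -1?(@padded_rev s j.+2) //;
    try lia.
  rewrite !eW; try lia.
  set i := size s + 3 - j.+2 - (size w + o + 2).
  have -> : size s + 3 - j.+1 - (size w + o + 2) = i.+1 by rewrite /i; lia.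
  have -> : size s + 3 - j - (size w + o + 2) = i.+2 by rewrite /i; lia.
  by case: (nw i) => ->; [right | left].
have [lej2|ltj2] := leqP (size w + o + 2) j.
  by rewrite !eW ?subSn; try lia; apply: nw.
have [->|nj] := eqVneq j (size w); first by right; rewrite !eM //; lia.
by left; rewrite !eM //; lia.
Qed.

Lemma admissible_mirror h o s : o <= 1 -> admissible s -> size s = h * 2 + o ->
  exists2 w, w \in half_words h & s = mirror o w.
Proof.
move=> o1 ads sz; have [As Rs ls ns] := ads; have s1 := admissible_size ads.
have h0 : 0 < h by lia.
exists (drop (h + o) s).
  apply/half_wordsP; split.
  - by rewrite size_drop; lia.
  - by apply/allP => d /mem_drop /(allP As).
  - rewrite -ls -{2}(cat_take_drop (h + o) s) last_cat.
    case E: (drop _ _) => //; have := congr1 size E; rewrite size_drop /=; lia.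
  - by move=> j; rewrite !nth_drop !addnS; apply: (ns (h + o + j).+2).
rewrite /mirror; have -> : rev (drop (h + o) s) = take h s.
  by rewrite rev_drop Rs; congr (take _ s); lia.
rewrite catA -{1}(cat_take_drop (h + o) s); congr (_ ++ _).
rewrite takeD; congr (_ ++ _).
have : o = 0 \/ o = 1 by lia.
case=> Eo; subst o; first by rewrite take0.
have sh : h < size s by lia.
rewrite (drop_nth 0) //= take0 -nth0 nth_drop addn0; congr [:: _].
(* The centre digit equals one neighbour, and the two neighbours agree by symmetry. *)
have := ns h.+1; rewrite /padded /= addn1 => -[|//] ->.
case: h h0 sz sh => // h _ sz sh /=.
by rewrite -{1}Rs nth_rev; [congr (nth 0 s _) |]; lia.
Qed.

Lemma mirror_inj h o (v w : seq nat) : v \in half_words h -> w \in half_words h ->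
  mirror o v = mirror o w -> v = w.
Proof.
move=> /half_wordsP[sv _ _ _] /half_wordsP[sw _ _ _] /eqP.
rewrite /mirror eqseq_cat ?size_rev ?sv ?sw // => /andP[/eqP/(congr1 rev)].
by rewrite !revK.
Qed.

Lemma num_reverse_multiples_fib g k b t :
  1 < g -> 0 < b ->
  (forall N, reverse_multiple g k N <->
     exists2 s, admissible s & N = b * (g ^ 2 - 1) * from_digits g s) ->
  (forall s, admissible s ->
     base_length g (b * (g ^ 2 - 1) * from_digits g s) = size s + 2) ->
  num_reverse_multiples g k t = fib (t %/ 2 - 1).
Proof.
(* A word of length [t - 2] has halves of length [h]. For [t < 4] truncation gives [h = 0], where
   there are no half words, so the formula holds for every [t]. *)
move=> g1 b0 rmP lenP; set h := t %/ 2 - 1; set o := t %% 2.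
have o1 : o <= 1 by rewrite -ltnS ltn_mod.
have gam0 : 0 < b * (g ^ 2 - 1) by rewrite muln_gt0 b0 subn_gt0 expnS; nia.
rewrite /num_reverse_multiples cardE -(size_map val) -size_half_words.
pose F w := b * (g ^ 2 - 1) * from_digits g (mirror o w).
rewrite -(size_map F); apply: perm_size; apply: uniq_perm.
- by rewrite map_inj_uniq ?enum_uniq //; apply: val_inj.
- rewrite map_inj_in_uniq ?half_words_uniq // => v w hv hw /eqP.
  rewrite /F eqn_pmul2l // => /eqP E.
  have av := mirror_admissible o1 hv; have aw := mirror_admissible o1 hw.
  apply: (@mirror_inj h o v w hv hw).
  by rewrite -(digits_admissible g1 av) E digits_admissible.
move=> N; apply/mapP/mapP.
  move=> [M]; rewrite mem_enum inE => /andP[/rmP[s ads EM] /eqP]; rewrite EM.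
  rewrite lenP // => szs EN.
  have [|w hw Es] := @admissible_mirror h o s o1 ads; first by rewrite /h /o; lia.
  by exists w; rewrite // EN /F -Es.
move=> [w hw ->]; have aw := mirror_admissible o1 hw.
have [sw _ _ _] := (half_wordsP _ _).1 hw.
have := admissible_size aw; rewrite size_mirror => sz1.
have lenF : base_length g (F w) = t by rewrite /F lenP // size_mirror sw /h /o; lia.
have F0 : 0 < F w.
  rewrite muln_gt0 gam0 from_digits_gt0 //; first exact: ltnW.
  by have [_ _ -> _] := aw.
have ltF : F w < g ^ t.
  move: lenF; rewrite /base_length /digits gtn_eqF // size_mkseq => <-.
  exact: trunc_log_ltn.
exists (Ordinal ltF) => //; rewrite mem_enum inE /= lenF eqxx andbT.
by apply/rmP; exists (mirror o w).
Qed.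

(** * Generating function and conclusion *)

(** Multiplication by the denominator gives [C n - C (n - 2) - C (n - 4)], which is zero from
    [n = 6] on by the Fibonacci recurrence; smaller coefficients are evaluated. *)
Lemma fib_series_quotient (C : nat -> int) :
  (forall t, C t = ((fib (t %/ 2 - 1))%:R)%R) ->
  is_series_quotient C ('X^4 * (1 + 'X))%R (1 - 'X^2 - 'X^4)%R.
Proof.
move=> CE.
have BE j : ((1 - 'X^2 - 'X^4 : {poly int})`_j =
    (j == 0)%:R - (j == 2)%:R - (j == 4)%:R)%R.
  by rewrite !coefB coef1 !coefXn.
have AE j : (('X^4 * (1 + 'X) : {poly int})`_j = (j == 4)%:R + (j == 5)%:R)%R.
  by rewrite mulrDr mulr1 -exprSr coefD !coefXn.
split=> [|n]; first by rewrite BE.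
rewrite AE; under eq_bigr => i _ do rewrite BE CE.
case: n => [|[|[|[|n]]]]; try by rewrite !big_ord_recr big_ord0.
rewrite 5!big_ord_recr /= big1 => [|i _]; last first.
  have lti := ltn_ord i.
  by do 3!(rewrite (_ : (_ == _) = false); last by lia); rewrite !subr0 mulr0.
rewrite subnn.
have -> : n.+4 - n = 4 by lia.
have -> : n.+4 - n.+1 = 3 by lia.
have -> : n.+4 - n.+2 = 2 by lia.
have -> : n.+4 - n.+3 = 1 by lia.
rewrite /= !subr0 !sub0r ?mulr0 !mulrN1 ?mulr1 ?addr0 add0r.
case: n => [|[|n]] //.
have -> : n.+2 %/ 2 - 1 = n %/ 2 by lia.
have -> : n.+4 %/ 2 - 1 = (n %/ 2).+1 by lia.
have -> : n.+2.+4 %/ 2 - 1 = (n %/ 2).+2 by lia.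
rewrite [fib _.+2]/(fib _.+1 + fib _) natrD /= addr0.
by rewrite addrC addrA addrK subrr.
Qed.

Lemma gamma_digits g k b : 0 < b -> g = k * b + b ->
  b * (g ^ 2 - 1) = from_digits g [:: k * b; g - 1; b - 1].
Proof.
move=> b0 gE; rewrite !from_digits_cons /from_digits big_ord0 muln0 addn0.
have [c Eb] : exists c, b = c.+1 by exists b.-1; lia.
have [d Eg] : exists d, g = d.+1 by exists g.-1; lia.
have -> : g ^ 2 - 1 = d * d + d + d by rewrite Eg expnS expn1; lia.
by move: gE; rewrite Eb Eg !subn1 /=; lia.
Qed.

Unset Implicit Arguments.

Theorem theorem2 (g k : nat) (hg : 3 <= g) (hk2 : 2 <= k) (hkg : k < g)
    (hdvd : k + 1 %| g)
    (hexists : young_graph_exists g k)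
    (h1089 : isomorphic (young_graph g k) graph1089) :
  let b := g %/ (k + 1) in
  let gamma := b * (g ^ 2 - 1) in
  (* (i) *)
  [/\ forall x, young_node g k x <->
        x \in [:: Start; Node 0 0; Node 0 (k - 1);
                  Node (k - 1) (k - 1); Node (k - 1) 0],
      forall x c a y, young_edge g k x (c, a) y <->
        (x, (c, a), y) \in
          [:: (Start, (b, k * b), Node 0 (k - 1));
              (Node 0 0, (0, 0), Node 0 0);
              (Node 0 0, (b, k * b), Node 0 (k - 1));
              (Node 0 (k - 1), (b - 1, k * b - 1), Node (k - 1) (k - 1));
              (Node (k - 1) (k - 1), (g - 1, g - 1), Node (k - 1) (k - 1));
              (Node (k - 1) (k - 1), (k * b - 1, b - 1), Node (k - 1) 0);
              (Node (k - 1) 0, (k * b, b), Node 0 0)]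
    & forall x, pivot g k x <-> x \in [:: Node 0 0; Node (k - 1) (k - 1)]] /\
  (* (ii) *)
  is_series_quotient (fun t => ((num_reverse_multiples g k t)%:R)%R)
    ('X^4 * (1 + 'X))%R (1 - 'X^2 - 'X^4)%R /\
  (* (iii) *)
  [/\ all (fun d => d < g) [:: k * b; g - 1; b - 1],
      gamma = from_digits g [:: k * b; g - 1; b - 1]
    & forall N, reverse_multiple g k N <->
        exists beta,
          [/\ 0 < beta,
              rev (digits g beta) = digits g beta,
              {subset digits g beta <= [:: 0; 1]},
              no_single_digits (digits g beta)
            & N = gamma * beta]] /\
  (* (iv) *)
  [/\ exists N, reverse_multiple g k N /\ base_length g N = 4,
      forall N, reverse_multiple g k N -> 4 <= base_length g N
    & forall t, 4 <= t -> num_reverse_multiples g k t = fib (t %/ 2 - 1)].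
Proof.
move=> b gamma.
have gE : g = (k + 1) * b by rewrite /b mulnC divnK.
rewrite {}/gamma; move: b gE => b gE {hdvd}.
have b0 : 0 < b by case: b gE => //; rewrite muln0; lia.
have kb : b <= k * b by rewrite leq_pmull // ltnW.
have gkb : g = k * b + b by rewrite {1}gE; lia.
have g1 : 1 < g by lia.
have [nodes edges pivots] := young_graph_1089 hk2 b0 gE h1089.
have fromA := fun s => @admissible_reverse_multiple g k b s hk2 b0 gE.
have toA N := @reverse_multiple_admissible g k b N hk2 b0 gE
  (fun x l y => (edges x l y).1).
have rmP N : reverse_multiple g k N <->
    exists2 s, admissible s & N = b * (g ^ 2 - 1) * from_digits g s.
  split=> [/toA[s [ads _ ->]]|[s ads ->]]; first by exists s.
  by have [] := fromA s ads.
have numE t : num_reverse_multiples g k t = fib (t %/ 2 - 1).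
  apply: (@num_reverse_multiples_fib g k b) => // s ads.
  by have [] := fromA s ads.
split; last split; last split.
- split=> // x c a y; rewrite edges /young_edges_1089 -gE; exact: iff_refl.
- by apply: fib_series_quotient => t; rewrite numE.
- split.
  + by rewrite /=; lia.
  + exact: gamma_digits.
  + move=> N; rewrite rmP; split=> [[s ads ->]|[beta [p1 p2 p3 p4 ->]]].
      exists (from_digits g s).
      have := (admissible_digitsP (from_digits g s) g1).2.
      by rewrite (digits_admissible g1 ads) => -[] //; split.
    have [ads Eb] := (admissible_digitsP beta g1).1 (And4 p1 p2 p3 p4).
    by exists (digits g beta) => //; rewrite {1}Eb.
split=> // [|N /toA[s [/admissible_size s1 <- _]]]; last by lia.
(* The shortest admissible word; for [g = 10], [k = 9] it yields 1089 itself. *)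
have ads : admissible [:: 1; 1].
  by split=> // -[|[|[|[|j]]]]; [left | right | left | right | right].
by have [rm len] := fromA _ ads; exists (b * (g ^ 2 - 1) * from_digits g [:: 1; 1]).
Qed.
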